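(* Let $1\le p\le r$ and let $\vec l=(l_1,\dots,l_p)$, $\vec\tau=(\tau_1,\dots,\tau_p)$ be integer vectors with $1\le l_1<\cdots<l_p=r$ and $1\le\tau_1<\cdots<\tau_p=r$. Suppose that at least one of the two sets $\Xi_r(\vec l;\vec\tau)$ and $\Theta_r(\vec l;\vec\tau)$ is not empty. Then $$\Xi_r(\vec l;\vec\tau)=\{\rho:\ \rho^{-1}\in\Theta_r(\vec l;\vec\tau)\}.$$
   Context: $\Theta_r(\vec l)$ is the set of permutations $\mu$ of $\{1,\dots,r\}$ such that: (Rule 1) $\mu(l_i)<\mu(l_{i+1})$ for $i=1,\dots,p-1$; (Rule 2) $\mu(y)<\mu(y')$ whenever $y<y'$ and $\mu(y),\mu(y')\in I_i$ for some $i$, where $I_1=\{1,\dots,\mu(l_1)\}$ and $I_i=\{\mu(l_{i-1})+1,\dots,\mu(l_i)\}$, $i=2,\dots,p$, is a partition of $\{1,\dots,r\}$. $\Theta_r(\vec l;\vec\tau)$ is the set of $\mu\in\Theta_r(\vec l)$ with $\mu(l_i)=\tau_i$, $i=1,\dots,p$. Put $\tau_0=0$ and $J_i=\{\tau_{i-1}+1,\dots,\tau_i\}$, $i=1,\dots,p$. $\Xi_r(\vec\tau)$ is the set of permutations $\rho$ of $\{1,\dots,r\}$ such that: (Rule 4) $\rho(\tau_i)<\rho(\tau_j)$ if $i<j$; (Rule 5) $\rho(y)<\rho(y')$ if $y<y'$ and $y,y'\in J_i$ for some $i$. $\Xi_r(\vec l;\vec\tau)$ is the set of $\rho\in\Xi_r(\vec\tau)$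 with $\rho(\tau_i)=l_i$, $i=1,\dots,p$. *)

(* Defs.v *)
From mathcomp Require Import all_boot all_fingroup.

Set Implicit Arguments.
Unset Strict Implicit.
Unset Printing Implicit Defensive.

(* All indices are 1-based, as in the mathematics: the entries of a vector [v]
   of length [p] are [ent v 1, ..., ent v p]; moreover [ent v 0 = 0], which is
   the convention tau_0 = 0. *)
Definition ent (p : nat) (v : p.-tuple nat) (i : nat) : nat :=
  nth 0 (0 :: v) i.

(* A permutation of {1, ..., r} is an element of ['S_r], a permutation of
   {0, ..., r-1}, conjugated by the shift k |-> k + 1: [papp mu y] is the value
   of [mu] at y in {1, ..., r}, and [papp mu y = y] outside of this range
   (where it is never used). *)
Definition papp (r : nat) (mu : 'S_r) (y : nat) : nat :=
  if y is k.+1 then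
    if insub k is Some i then (mu i : 'I_r).+1 else y
  else 0.

Section Rules.
Variables (r p : nat).
Implicit Types (l tau : p.-tuple nat) (mu rho : 'S_r).

Definition in_I l mu (i z : nat) : bool :=
  (if i == 1 then 0 else papp mu (ent l i.-1)) < z <= papp mu (ent l i).

Definition in_J tau (i y : nat) : bool := ent tau i.-1 < y <= ent tau i.

(* Quantifiers over {1, ..., n} are quantifiers over the positive elements of
   ['I_n.+1]. *)

Definition rule1 l mu : bool :=
  [forall i : 'I_p.+1, (0 < i < p) ==>
    (papp mu (ent l i) < papp mu (ent l i.+1))].

Definition rule2 l mu : bool :=
  [forall i : 'I_p.+1, forall y : 'I_r.+1, forall y' : 'I_r.+1,
    [&& 0 < i, 0 < y, 0 < y', y < y',
        in_I l mu i (papp mu y) & in_I l mu i (papp mu y')] ==>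
    (papp mu y < papp mu y')].

Definition rule4 tau rho : bool :=
  [forall i : 'I_p.+1, forall j : 'I_p.+1, [&& 0 < i, 0 < j & i < j] ==>
    (papp rho (ent tau i) < papp rho (ent tau j))].

Definition rule5 tau rho : bool :=
  [forall i : 'I_p.+1, forall y : 'I_r.+1, forall y' : 'I_r.+1,
    [&& 0 < i, 0 < y, 0 < y', y < y', in_J tau i y & in_J tau i y'] ==>
    (papp rho y < papp rho y')].

End Rules.

Definition Theta (r p : nat) (l : p.-tuple nat) : {set 'S_r} :=
  [set mu | rule1 l mu && rule2 l mu].

Definition Theta_at (r p : nat) (l tau : p.-tuple nat) : {set 'S_r} :=
  [set mu in Theta r l |
    [forall i : 'I_p.+1, (0 < i) ==> (papp mu (ent l i) == ent tau i)]].

Definition Xi (r p : nat) (tau : p.-tuple nat) : {set 'S_r} :=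
  [set rho | rule4 tau rho && rule5 tau rho].

Definition Xi_at (r p : nat) (l tau : p.-tuple nat) : {set 'S_r} :=
  [set rho in Xi r tau |
    [forall i : 'I_p.+1, (0 < i) ==> (papp rho (ent tau i) == ent l i)]].

(* Main.v *)
Require Import Defs.
From mathcomp Require Import all_boot all_fingroup.

Set Implicit Arguments.
Unset Strict Implicit.
Unset Printing Implicit Defensive.

(** The two sets describe the same condition read through a bijection and
    through its inverse.  Put mu = rho^-1.  The prescribed values
    rho(tau_i) = l_i and mu(l_i) = tau_i are equivalent, and they settle the
    rest: Rules 1 and 4 become the monotonicity of the vectors tau and l, while
    the interval I_i, whose end points are values of mu, becomes J_i.  Rule 5
    then says that rho is increasing on J_i, and Rule 2 that mu is increasing on
    the preimage of J_i under mu, that is, on rho(J_i).  A bijection of a total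
    order is increasing on a set exactly when its inverse is increasing on the
    image of that set ([homo_lt_inv]), so these two rules agree as well
    ([rule5_inv]). *)

Section PermutationOfIndices.

Variable r : nat.
Implicit Types mu : 'S_r.

Lemma papp_ord mu (i : 'I_r) : papp mu i.+1 = (mu i).+1.
Proof. by rewrite /papp insubT //= => ltir; congr (mu _).+1; apply: val_inj. Qed.

Lemma papp_out mu y : r < y -> papp mu y = y.
Proof. by case: y => // k; rewrite ltnS /papp => lerk; rewrite insubF // ltnNge lerk. Qed.

(** As [papp] is the identity outside of {1, ..., r}, cancellation holds on all
    of [nat], which spares every range condition on the entries of the
    vectors. *)
Lemma pappK mu : cancel (papp mu) (papp mu^-1).
Proof.
move=> y; have [leyr | ltry] := leqP y r; last by rewrite !papp_out.
case: y leyr => // k ltkr.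
by rewrite -[k]/(val (Ordinal ltkr)) !papp_ord permK.
Qed.

Lemma pappVK mu : cancel (papp mu^-1) (papp mu).
Proof. by move=> y; rewrite -{1}[mu]invgK pappK. Qed.

Lemma papp_range mu y : (0 < papp mu y <= r) = (0 < y <= r).
Proof.
have [leyr | ltry] := leqP y r; last by rewrite papp_out // [y <= r]leqNgt ltry.
by case: y leyr => // k ltkr; rewrite -[k]/(val (Ordinal ltkr)) papp_ord ltn_ord.
Qed.

End PermutationOfIndices.

Lemma homo_lt_inv (D : pred nat) (f g : nat -> nat) :
    cancel g f -> {in D &, {homo f : x y / x < y}} ->
  {in [preim g of D] &, {homo g : x y / x < y}}.
Proof.
move=> gK f_homo x y Dx Dy ltxy; rewrite ltnNge leq_eqVlt; apply/negP.
case/predU1P=> [/(can_inj gK) eq_yx | ltg]; first by rewrite eq_yx ltnn in ltxy.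
by have := f_homo _ _ Dy Dx ltg; rewrite !gK ltnNge (ltnW ltxy).
Qed.

Section Rules.

Variables (r p : nat).
Implicit Types (l tau : p.-tuple nat) (mu rho : 'S_r).

Lemma valuesP l tau mu :
  reflect (forall i, 0 < i <= p -> papp mu (ent l i) = ent tau i)
          [forall i : 'I_p.+1, (0 < i) ==> (papp mu (ent l i) == ent tau i)].
Proof.
apply: (iffP forallP) => [H i /andP[i_gt0 leip] | H i].
  by have /implyP/(_ i_gt0)/eqP := H (Ordinal (leip : i < p.+1)).
by apply/implyP=> i_gt0; apply/eqP/H; rewrite i_gt0 -ltnS ltn_ord.
Qed.

Lemma rule2P l mu :
  reflect (forall i, 0 < i <= p ->
             {in [pred y | (0 < y <= r) && in_I l mu i (papp mu y)] &,
                {homo papp mu : y y' / y < y'}})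
          (rule2 l mu).
Proof.
apply: (iffP forallP) => [H i /andP[i0 ip] y y' | H i].
  rewrite !inE => /andP[/andP[y0 yr] Iy] /andP[/andP[y'0 y'r] Iy'] ltyy'.
  have /forallP/(_ (Ordinal (yr : y < r.+1))) := H (Ordinal (ip : i < p.+1)).
  move/forallP/(_ (Ordinal (y'r : y' < r.+1)))/implyP; apply=> /=.
  by rewrite i0 y0 y'0 ltyy' Iy.
apply/forallP=> y; apply/forallP=> y'; apply/implyP.
case/and5P=> i0 y0 y'0 ltyy' /andP[Iy Iy']; have ip := ltn_ord i.
by apply: (H i) => //; rewrite ?i0 // inE ?y0 ?y'0 ?Iy ?Iy' -ltnS ltn_ord.
Qed.

Lemma rule5P tau rho :
  reflect (forall i, 0 < i <= p ->
             {in [pred y | (0 < y <= r) && in_J tau i y] &,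
                {homo papp rho : y y' / y < y'}})
          (rule5 tau rho).
Proof.
apply: (iffP forallP) => [H i /andP[i0 ip] y y' | H i].
  rewrite !inE => /andP[/andP[y0 yr] Jy] /andP[/andP[y'0 y'r] Jy'] ltyy'.
  have /forallP/(_ (Ordinal (yr : y < r.+1))) := H (Ordinal (ip : i < p.+1)).
  move/forallP/(_ (Ordinal (y'r : y' < r.+1)))/implyP; apply=> /=.
  by rewrite i0 y0 y'0 ltyy' Jy.
apply/forallP=> y; apply/forallP=> y'; apply/implyP.
case/and5P=> i0 y0 y'0 ltyy' /andP[Jy Jy']; have ip := ltn_ord i.
by apply: (H i) => //; rewrite ?i0 // inE ?y0 ?y'0 ?Jy ?Jy' -ltnS ltn_ord.
Qed.

Lemma ent_homo l :
    (forall i, 1 <= i < p -> ent l i < ent l i.+1) ->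
  forall i j, 0 < i -> i < j <= p -> ent l i < ent l j.
Proof.
move=> l_incr i j i_gt0; elim: j => // j IHj /andP[leij ltjp].
have ltj : ent l j < ent l j.+1 by rewrite l_incr ?ltjp ?(leq_trans i_gt0).
move: leij; rewrite ltnS leq_eqVlt => /predU1P[-> // | ltij].
by apply: ltn_trans ltj; rewrite IHj // ltij ltnW.
Qed.

(** The case i = 1 of [in_I] matches the convention tau_0 = 0 of [in_J]. *)
Lemma in_I_J l tau mu :
    (forall i, 0 < i <= p -> papp mu (ent l i) = ent tau i) ->
  forall i z, 0 < i <= p -> in_I l mu i z = in_J tau i z.
Proof.
move=> mu_l [|[|i]] z // ip; rewrite /in_I /in_J (mu_l _ ip) //.
by rewrite -[i.+2.-1]/i.+1 mu_l //; apply: ltnW.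
Qed.

Lemma rule5_inv l tau rho :
    (forall i, 0 < i <= p -> papp rho^-1 (ent l i) = ent tau i) ->
  rule5 tau rho = rule2 l rho^-1.
Proof.
move=> mu_l; apply/rule5P/rule2P => homo_i i ip y y'.
  rewrite !inE !(in_I_J mu_l) // -(papp_range rho^-1 y) -(papp_range rho^-1 y').
  by apply: (homo_lt_inv (pappVK rho) (homo_i i ip)).
move=> Dy Dy'; apply: (homo_lt_inv (pappK rho) (homo_i i ip)); rewrite !inE.
  by rewrite pappK papp_range (in_I_J mu_l).
by rewrite pappK papp_range (in_I_J mu_l).
Qed.

Lemma rule1_at l tau mu :
    (forall i, 1 <= i < p -> ent tau i < ent tau i.+1) ->
    (forall i, 0 < i <= p -> papp mu (ent l i) = ent tau i) ->
  rule1 l mu.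
Proof.
move=> tau_incr mu_l; apply/forallP=> i; apply/implyP=> /andP[i0 ip].
by rewrite !mu_l ?i0 ?(ltnW ip) // tau_incr ?i0.
Qed.

Lemma rule4_at l tau rho :
    (forall i, 1 <= i < p -> ent l i < ent l i.+1) ->
    (forall i, 0 < i <= p -> papp rho (ent tau i) = ent l i) ->
  rule4 tau rho.
Proof.
move=> l_incr rho_tau; apply/forallP=> i; apply/forallP=> j.
apply/implyP=> /and3P[i0 j0 ltij]; have [ip jp] := (ltn_ord i, ltn_ord j).
by rewrite !rho_tau ?i0 ?j0 // (ent_homo l_incr i0) ?ltij.
Qed.

End Rules.

Theorem proposition2p5 (r p : nat) (hp : 1 <= p) (hpr : p <= r)
    (l tau : p.-tuple nat)
    (hl1 : 1 <= ent l 1)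
    (hl : forall i : nat, 1 <= i < p -> ent l i < ent l i.+1)
    (hlp : ent l p = r)
    (htau1 : 1 <= ent tau 1)
    (htau : forall i : nat, 1 <= i < p -> ent tau i < ent tau i.+1)
    (htaup : ent tau p = r)
    (hne : Xi_at r l tau != set0 \/ Theta_at r l tau != set0) :
  Xi_at r l tau = [set rho : 'S_r | (rho^-1)%g \in Theta_at r l tau].
Proof.
apply/setP=> rho; rewrite !inE.
apply/andP/andP=> [[/andP[_ rho5] /valuesP rho_tau]
                 | [/andP[_ mu2] /valuesP mu_l]].
  have mu_l i : 0 < i <= p -> papp rho^-1 (ent l i) = ent tau i.
    by move/rho_tau<-; rewrite pappK.
  by rewrite (rule1_at htau mu_l) -(rule5_inv mu_l) rho5; split=> //; apply/valuesP.
have rho_tau i : 0 < i <= p -> papp rho (ent tau i) = ent l i.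
  by move/mu_l<-; rewrite pappVK.
by rewrite (rule4_at hl rho_tau) (rule5_inv mu_l) mu2; split=> //; apply/valuesP.
Qed.
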